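(* Let $R$ be a ring and let $A=\sigma(R)\langle x_1,\dots,x_n\rangle$ be a skew PBW extension of $R$ with associated families $\Sigma=\{\sigma_1,\dots,\sigma_n\}$ and $\Delta=\{\delta_1,\dots,\delta_n\}$, such that the elements $c_{i,j}$ are central in $R$ for all $i,j$. Suppose that $R$ is reversible and $(\Sigma,\Delta)$-compatible. Then $R$ is weak symmetric if and only if $A$ is weak symmetric.
   Context: Rings are associative with unity, not necessarily commutative. For a ring $B$, $\mathrm{nil}(B)$ is the set of nilpotent elements of $B$. Skew PBW extension: a ring $A$ is a skew PBW extension of a ring $R$, written $A=\sigma(R)\langle x_1,\dots,x_n\rangle$, if: (i) $R\subseteq A$ (as a subring); (ii) there are $x_1,\dots,x_n\in A$ such that $A$ is a left free $R$-module with basis $\mathrm{Mon}(A)=\{x^{\alpha}=x_1^{\alpha_1}\cdots x_n^{\alpha_n}\mid \alpha\in\mathbb{N}^n\}$, where $x_1^0\cdots x_n^0=1$; (iii) for each $i$ and each $r\in R\setminus\{0\}$ there is $c_{i,r}\in R\setminus\{0\}$ with $x_ir-c_{i,r}x_i\in R$; (iv) for all $1\le i,j\le n$ there is $c_{i,j}\in R\setminus\{0\}$ with $x_jx_i-c_{i,j}x_ix_j\in R+Rx_1+\cdots+Rx_n$. It is known that for each $i$ there are an injective endomorphism $\sigma_i:R\to R$ and a $\sigma_i$-derivation $\delta_i:R\to R$ (i.e. $\delta_i$ is additive and $\delta_i(rs)=\sigma_i(r)\delta_i(s)+\delta_i(r)s$) such that $x_ir=\sigma_i(r)x_i+\delta_i(r)$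 for all $r\in R$; these form the associated families $\Sigma$ and $\Delta$. For $\alpha,\beta\in\mathbb{N}^n$ put $\sigma^\alpha=\sigma_1^{\alpha_1}\cdots\sigma_n^{\alpha_n}$ and $\delta^\beta=\delta_1^{\beta_1}\cdots\delta_n^{\beta_n}$ (compositions). $R$ is $\Sigma$-compatible if for all $a,b\in R$ and every $\alpha\in\mathbb{N}^n$: $a\sigma^\alpha(b)=0$ if and only if $ab=0$. $R$ is $\Delta$-compatible if for all $a,b\in R$: $ab=0$ implies $a\delta^\beta(b)=0$ for every $\beta\in\mathbb{N}^n$. $R$ is $(\Sigma,\Delta)$-compatible if it is both. A ring $B$ is reversible if $ab=0$ implies $ba=0$ for all $a,b\in B$. A ring $B$ is weak symmetric if $abc\in\mathrm{nil}(B)$ implies $acb\in\mathrm{nil}(B)$ for all $a,b,c\in B$. *)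

(* Defs.v *)
(* Mathematical Components. *)
From HB Require Import structures.
From mathcomp Require Import all_boot all_order all_algebra.

Set Implicit Arguments.
Unset Strict Implicit.
Unset Printing Implicit Defensive.

Import GRing.Theory.
Local Open Scope ring_scope.

(* Rings are unital and possibly zero, hence [pzRingType]. *)

Definition is_nilpotent (B : pzRingType) (a : B) : Prop :=
  exists k : nat, a ^+ k = 0.

Definition reversible_ring (B : pzRingType) : Prop :=
  forall a b : B, a * b = 0 -> b * a = 0.

Definition weak_symmetric (B : pzRingType) : Prop :=
  forall a b c : B, is_nilpotent (a * b * c) -> is_nilpotent (a * c * b).

Definition central (R : pzRingType) (c : R) : Prop :=
  forall r : R, GRing.comm c r.

(* The inclusion of R in A is an injective ring morphism [iota]; A is a left
   R-module through r . a := iota r * a. *)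
Section SkewPBW.

Variables (R A : pzRingType) (iota : {rmorphism R -> A}) (n : nat).
Variable x : 'I_n -> A.

Definition exponent := {ffun 'I_n -> nat}.

(* The factors occur in increasing order of the index. *)
Definition monomial (alpha : exponent) : A := \prod_(i < n) x i ^+ alpha i.

(* Linear independence is that of the family indexed by exponents, so distinct
   exponents give distinct monomials unless R is the zero ring. *)
Definition monomials_basis : Prop :=
  (forall a : A, exists (s : seq exponent) (f : exponent -> R),
     a = \sum_(alpha <- s) iota (f alpha) * monomial alpha) /\
  (forall (s : seq exponent) (f : exponent -> R), uniq s ->
     \sum_(alpha <- s) iota (f alpha) * monomial alpha = 0 ->
     forall alpha, alpha \in s -> f alpha = 0).

Definition swap_coefficient (i j : 'I_n) (c : R) : Prop :=
  c <> 0 /\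
  exists (r0 : R) (r : 'I_n -> R),
    x j * x i - iota c * x i * x j = iota r0 + \sum_(k < n) iota (r k) * x k.

Definition skew_PBW_extension : Prop :=
  [/\ injective iota,
      monomials_basis,
      (forall (i : 'I_n) (r : R), r <> 0 ->
         exists c : R, c <> 0 /\
           exists d : R, x i * iota r - iota c * x i = iota d)
    & (forall i j : 'I_n, exists c : R, swap_coefficient i j c)].

Definition skew_derivation (s : {rmorphism R -> R}) (d : {additive R -> R}) :
    Prop :=
  forall a b : R, d (a * b) = s a * d b + d a * b.

(* The last clause determines sigma and delta when the monomials form a
   basis. *)
Definition associated_families
    (sigma : 'I_n -> {rmorphism R -> R}) (delta : 'I_n -> {additive R -> R}) :
    Prop :=
  [/\ (forall i, injective (sigma i)),
      (forall i, skew_derivation (sigma i) (delta i))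
    & (forall i (r : R),
         x i * iota r = iota (sigma i r) * x i + iota (delta i r))].

End SkewPBW.

Section Compatibility.

Variables (R : pzRingType) (n : nat).

(* f_1^{alpha_1} o ... o f_n^{alpha_n}: the power of f_n is applied first. *)
Definition comp_power (f : 'I_n -> R -> R) (alpha : exponent n) : R -> R :=
  \big[@comp R R R/id]_(i < n) iter (alpha i) (f i).

Definition Sigma_compatible (sigma : 'I_n -> {rmorphism R -> R}) : Prop :=
  forall (a b : R) (alpha : exponent n),
    a * comp_power (fun i => sigma i) alpha b = 0 <-> a * b = 0.

Definition Delta_compatible (delta : 'I_n -> {additive R -> R}) : Prop :=
  forall a b : R, a * b = 0 ->
    forall beta : exponent n, a * comp_power (fun i => delta i) beta b = 0.

Definition Sigma_Delta_compatible
    (sigma : 'I_n -> {rmorphism R -> R}) (delta : 'I_n -> {additive R -> R}) :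
    Prop :=
  Sigma_compatible sigma /\ Delta_compatible delta.

End Compatibility.

(* Main.v *)
Require Import Defs.
From HB Require Import structures.
From mathcomp Require Import all_boot all_order all_algebra.
From mathcomp Require Import zify.

(** Let [N] be the set of nilpotent elements of [R] and [NA] the set of elements
    of [A] whose coordinates in the monomial basis all lie in [N]. The reason
    for the theorem is that [NA] is at once the set of nilpotent elements of [A]
    and a two-sided ideal, completely semiprime in the sense that [f * f] in
    [NA] implies [f] in [NA]. In any ring such an ideal contains [b a] with
    [a b], hence [a r b] with [a b], hence [a d b] with [a b d]; this is weak
    symmetry of [A]. Weak symmetry of [R] follows from that of [A] because the
    inclusion is injective.

    _Elements of [NA] are nilpotent_ ([nilpotent_coef_in]). If [a ^ p = 0] then,
    by reversibility and compatibility, every product of [p] elements obtained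
    from [a] by repeatedly applying the [sigma i] and [delta i] vanishes
    ([prod_skew_orbit_eq0]). For each [k], the elements of [R] that annihilate
    all products of [k] such elements form an ideal [K k], and multiplication
    on the right by any multiple of [a] in [A] sends elements with coordinates
    in [K (k + 1)] to elements with coordinates in [K k]. As [1] is in [K p] and
    [K 0 = 0], the ideal generated by [a] in [A] has nilpotent elements only,
    and [a y + g] is nilpotent whenever [g] is ([nilpotent_add_iota]); an
    induction on the number of terms concludes. Applied to constants, the same
    result shows that [N] is an ideal of [R], whence [NA] is an ideal of [A].

    _[NA] is completely semiprime_ ([coef_in_nil_square]). For [i] distinct from
    [j] the commutation coefficients [c i j] and [c j i] are inverse to each
    other ([swap_coefficient_inv]), so that, up to terms of smaller degree,
    [x^beta r x^gamma] is [sigma^beta(r) u x^(beta + gamma)] with [u] right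
    invertible ([coef_monomial_mul]). Given [f] with [f * f] in [NA], let
    [alpha] be an exponent of [f] of largest degree and, among these, of largest
    sum of squares. By the parallelogram identity [2 alpha] is a sum of two such
    exponents in only one way, so the coordinate of [f * f] at [2 alpha] is
    [a sigma^alpha(a) u], where [a] is the coordinate of [f] at [alpha]. It is
    nilpotent, and compatibility modulo [N] shows that [a * a], hence [a], is
    nilpotent. Removing the term of exponent [alpha] does not affect [f * f]
    modulo [NA], and the other terms are treated in the same way. *)

Set Implicit Arguments.
Unset Strict Implicit.
Unset Printing Implicit Defensive.

Import GRing.Theory.
Local Open Scope ring_scope.

(** * Nilpotent elements of a compatible reversible ring *)

Section CompPower.

Variables (T : pzRingType) (n : nat) (f : 'I_n -> T -> T).

Lemma comp_power_unit (i : 'I_n) (b : T) :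
  comp_power f [ffun j => (j == i : nat)] b = f i b.
Proof.
rewrite /comp_power.
have H : forall s : seq 'I_n, uniq s ->
    (\big[@comp T T T/id]_(j <- s) iter ([ffun j => (j == i : nat)] j) (f j)) b
    = if i \in s then f i b else b.
  elim=> [|j s IH]; first by rewrite big_nil.
  rewrite cons_uniq => /andP[js us]; rewrite big_cons [LHS]/= IH //.
  rewrite ffunE in_cons.
  have [<-|ji] := eqVneq j i; first by rewrite (negbTE js).
  by [].
by rewrite H ?index_enum_uniq // mem_index_enum.
Qed.

End CompPower.

Section Reversible.

Variable R : pzRingType.
Hypothesis hrev : reversible_ring R.

Lemma reversible_semicommutative (a r b : R) : a * b = 0 -> a * r * b = 0.
Proof. by move=> /hrev ba0; apply: hrev; rewrite mulrA ba0 mul0r. Qed.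

Variables (n : nat) (sigma : 'I_n -> {rmorphism R -> R}).
Variable delta : 'I_n -> {additive R -> R}.
Hypothesis hcompat : Sigma_Delta_compatible sigma delta.

Lemma sigma_compatible (i : 'I_n) (a b : R) : a * sigma i b = 0 <-> a * b = 0.
Proof.
have [hs _] := hcompat.
by have := hs a b [ffun j => (j == i : nat)]; rewrite comp_power_unit.
Qed.

Lemma delta_compatible (i : 'I_n) (a b : R) : a * b = 0 -> a * delta i b = 0.
Proof.
have [_ hd] := hcompat => /hd /(_ [ffun j => (j == i : nat)]).
by rewrite comp_power_unit.
Qed.

(** The smallest set containing [a] and stable under all the [sigma i] and
    [delta i]. *)
Inductive skew_orbit (a : R) : R -> Prop :=
| skew_orbit_refl : skew_orbit a a
| skew_orbit_sigma i b : skew_orbit a b -> skew_orbit a (sigma i b)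
| skew_orbit_delta i b : skew_orbit a b -> skew_orbit a (delta i b).

Lemma skew_orbit_annihilated (a b c : R) :
  skew_orbit a b -> c * a = 0 -> c * b = 0.
Proof.
move=> ab ca0; elim: ab => // i b' _ IH; first exact/sigma_compatible.
exact: delta_compatible.
Qed.

(** Reversibility brings each factor [a] to the right end of the product, where
    compatibility allows it to be replaced by an element of its orbit. *)
Lemma prod_skew_orbit_eq0 (a : R) (m : nat) (bs : seq R) :
  (forall b, b \in bs -> skew_orbit a b) ->
  a ^+ (m + size bs) = 0 -> a ^+ m * \prod_(b <- bs) b = 0.
Proof.
elim: bs m => [|b bs IH] m hbs; first by rewrite addn0 big_nil mulr1.
rewrite /= addnS -addSn => /IH H.
have /H/hrev : forall c, c \in bs -> skew_orbit a c.
  by move=> c cbs; apply: hbs; rewrite in_cons cbs orbT.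
rewrite exprSr mulrA => /(skew_orbit_annihilated (hbs b _)).
rewrite mem_head => /(_ isT); rewrite -mulrA => /hrev.
by rewrite big_cons mulrA.
Qed.

Lemma nilpotent_skew_orbit (a b : R) :
  skew_orbit a b -> is_nilpotent a -> is_nilpotent b.
Proof.
move=> ab [k ak]; exists k.
have := @prod_skew_orbit_eq0 a 0 (nseq k b).
rewrite size_nseq expr0 mul1r big_nseq iter_mulr mulr1; apply=> //.
by move=> c /nseqP[->].
Qed.

(** One half of compatibility with [sigma i] modulo nilpotent elements. *)
Lemma nilpotent_mul_sigma (i : 'I_n) (a b : R) :
  is_nilpotent (a * sigma i b) -> is_nilpotent (a * b).
Proof.
case=> k hk; exists k; move: hk.
(* The factors are corrected one by one, in products
   (a * sigma i b) ^+ k * (a * b) ^+ l. *)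
rewrite -[X in X = 0 -> _]mulr1 -(expr0 (a * b)) -[in (a * b) ^+ k](addn0 k).
elim: k 0%N => [|k IH] l; first by rewrite expr0 mul1r.
rewrite addSn -addnS => hk; apply: IH.
move: hk => /hrev; rewrite exprSr !mulrA => /sigma_compatible.
by rewrite -(mulrA _ a) -mulrA => /hrev; rewrite -mulrA -exprS.
Qed.

(** The left annihilator of all products of [k] elements of the orbit of
    [a]. *)
Definition orbit_annihilator (a : R) (k : nat) (r : R) : Prop :=
  forall bs : seq R, size bs = k -> (forall b, b \in bs -> skew_orbit a b) ->
    r * \prod_(b <- bs) b = 0.

Lemma orbit_annihilator_step (a : R) (k : nat) (r s b : R) :
  orbit_annihilator a k.+1 r -> skew_orbit a b ->
  orbit_annihilator a k (r * s * b).
Proof.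
move=> hr ab bs hk hbs.
have /(reversible_semicommutative s) : r * \prod_(c <- b :: bs) c = 0.
  apply: hr => [|c]; first by rewrite /= hk.
  by rewrite in_cons => /predU1P[->|/hbs].
by rewrite big_cons !mulrA.
Qed.

End Reversible.

(** * Right ideals and coordinatewise extension *)

(** Enough closure for the elements whose coordinates satisfy [K] to form a
    right ideal of the extension. *)
Definition right_ideal (R : pzRingType) (K : R -> Prop) : Prop :=
  [/\ K 0, (forall a b, K a -> K b -> K (a + b))
    & (forall a r, K a -> K (a * r))].

Lemma right_ideal_sum (R : pzRingType) (K : R -> Prop) (I : eqType) (s : seq I)
    (F : I -> R) :
  right_ideal K -> (forall i, i \in s -> K (F i)) -> K (\sum_(i <- s) F i).
Proof.
case=> K0 KD _ hF; rewrite big_seq.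
by elim/big_rec: _ => [//|i a /hF Fi Ka]; apply: KD.
Qed.

Lemma orbit_annihilator_right_ideal (R : pzRingType) (hrev : reversible_ring R)
    (n : nat) (sigma : 'I_n -> {rmorphism R -> R})
    (delta : 'I_n -> {additive R -> R}) (a : R) (k : nat) :
  right_ideal (orbit_annihilator sigma delta a k).
Proof.
split=> [bs _ _|r s hr hs bs hk hbs|r s hr bs hk hbs]; first by rewrite mul0r.
  by rewrite mulrDl hr ?hs ?addr0.
exact/reversible_semicommutative/hr.
Qed.

(** * Coordinates with respect to the monomials *)

Section Extension.

Variables (R A : pzRingType) (iota : {rmorphism R -> A}) (n : nat).
Variable x : 'I_n -> A.
Hypothesis hbasis : monomials_basis iota x.

(** The combination of monomials listed by [t]; exponents may be repeated. *)
Definition lincomb (t : seq (exponent n * R)) : A :=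
  \sum_(p <- t) iota p.2 * monomial x p.1.

Lemma lincomb_collect (t : seq (exponent n * R)) :
  lincomb t = \sum_(alpha <- undup (map fst t))
                iota (\sum_(p <- t | p.1 == alpha) p.2) * monomial x alpha.
Proof.
transitivity (\sum_(alpha <- undup (map fst t)) \sum_(p <- t | p.1 == alpha)
                iota p.2 * monomial x p.1); last first.
  apply: eq_bigr => alpha _; rewrite rmorph_sum mulr_suml.
  by apply: eq_bigr => p /eqP->.
rewrite (exchange_big_dep xpredT) //= /lincomb.
rewrite big_seq [RHS]big_seq; apply: eq_bigr => p pt.
rewrite -big_filter (eq_filter (a2 := pred1 p.1)) => [|alpha]; last first.
  by rewrite /= eq_sym.
by rewrite filter_pred1_uniq ?undup_uniq ?big_seq1 // mem_undup map_f.
Qed.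

Lemma lincomb_free (t : seq (exponent n * R)) (alpha : exponent n) :
  lincomb t = 0 -> \sum_(p <- t | p.1 == alpha) p.2 = 0.
Proof.
have [_ hfree] := hbasis.
rewrite lincomb_collect => /(hfree _ _ (undup_uniq _)) H.
have [/H//|] := boolP (alpha \in undup (map fst t)).
rewrite mem_undup => /negP alphaNt.
rewrite big_seq_cond big1 // => p /andP[pt /eqP palpha].
by case: alphaNt; rewrite -palpha map_f.
Qed.

Lemma lincomb_exists (a : A) : exists t : seq (exponent n * R), a == lincomb t.
Proof.
have [hspan _] := hbasis; have [s [f ->]] := hspan a.
by exists [seq (alpha, f alpha) | alpha <- s]; rewrite /lincomb big_map.
Qed.

(** The coordinate of [a] on the monomial of exponent [alpha], read off
    a chosen expression of [a] as a linear combination of monomials. *)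
Definition coef (a : A) (alpha : exponent n) : R :=
  \sum_(p <- xchoose (lincomb_exists a) | p.1 == alpha) p.2.

Lemma coef_lincomb (t : seq (exponent n * R)) (alpha : exponent n) :
  coef (lincomb t) alpha = \sum_(p <- t | p.1 == alpha) p.2.
Proof.
rewrite /coef; set s := xchoose _.
have sE : lincomb t = lincomb s := eqP (xchooseP (lincomb_exists (lincomb t))).
have := @lincomb_free (s ++ [seq (p.1, - p.2) | p <- t]) alpha.
rewrite big_cat /= big_map /= sumrN => H; apply/eqP; rewrite -subr_eq0 H //.
rewrite {1}/lincomb big_cat big_map /= -/(lincomb s) -sE /lincomb -big_split /=.
by rewrite big1 // => p _; rewrite rmorphN mulNr addrN.
Qed.

Lemma coef_expansion (a : A) :
  exists2 s, uniq s
    & a = \sum_(alpha <- s) iota (coef a alpha) * monomial x alpha.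
Proof.
have [t /eqP aE] := lincomb_exists a.
exists (undup (map fst t)); first exact: undup_uniq.
rewrite {1}aE lincomb_collect; apply: eq_bigr => alpha _.
by rewrite aE coef_lincomb.
Qed.

Lemma coefD (a b : A) (alpha : exponent n) :
  coef (a + b) alpha = coef a alpha + coef b alpha.
Proof.
have [t /eqP ->] := lincomb_exists a; have [s /eqP ->] := lincomb_exists b.
by rewrite -[lincomb t + _]big_cat -/(lincomb _) !coef_lincomb big_cat.
Qed.

Lemma coefZ (r : R) (a : A) (alpha : exponent n) :
  coef (iota r * a) alpha = r * coef a alpha.
Proof.
have [t /eqP ->] := lincomb_exists a.
have -> : iota r * lincomb t = lincomb [seq (p.1, r * p.2) | p <- t].
  rewrite /lincomb big_map mulr_sumr; apply: eq_bigr => p _.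
  by rewrite mulrA -rmorphM.
by rewrite !coef_lincomb big_map mulr_sumr.
Qed.

Lemma coef0 (alpha : exponent n) : coef 0 alpha = 0.
Proof. by rewrite -(mul0r 0) -(rmorph0 iota) coefZ mul0r. Qed.

Lemma coef_monomial (mu alpha : exponent n) :
  coef (monomial x mu) alpha = (mu == alpha)%:R.
Proof.
have -> : monomial x mu = lincomb [:: (mu, 1)].
  by rewrite /lincomb big_seq1 rmorph1 mul1r.
by rewrite coef_lincomb big_mkcond big_seq1 /=; case: eqP.
Qed.

Lemma coef_sum (I : Type) (s : seq I) (F : I -> A) (alpha : exponent n) :
  coef (\sum_(i <- s) F i) alpha = \sum_(i <- s) coef (F i) alpha.
Proof.
by apply: (big_morph (coef^~ alpha)) => [a b|]; rewrite ?coefD ?coef0.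
Qed.

Lemma coef_eq0 (a : A) : (forall alpha, coef a alpha = 0) -> a = 0.
Proof.
move=> H; have [s _ ->] := coef_expansion a.
by rewrite big1 // => alpha _; rewrite H rmorph0 mul0r.
Qed.

(** The elements all of whose coordinates satisfy [K]. *)
Definition coef_in (K : R -> Prop) (a : A) : Prop :=
  forall alpha, K (coef a alpha).

Section CoefIn.

Variable K : R -> Prop.
Hypothesis hK : right_ideal K.

Lemma coef_inD (a b : A) : coef_in K a -> coef_in K b -> coef_in K (a + b).
Proof. by have [_ KD _] := hK => Ka Kb alpha; rewrite coefD; apply: KD. Qed.

Lemma coef_in_iotaM (r : R) (a : A) : K r -> coef_in K (iota r * a).
Proof. by have [_ _ KM] := hK => Kr alpha; rewrite coefZ; apply: KM. Qed.

Lemma coef_in_sum (I : eqType) (s : seq I) (F : I -> A) :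
  (forall i, i \in s -> coef_in K (F i)) -> coef_in K (\sum_(i <- s) F i).
Proof.
move=> KF alpha; rewrite coef_sum; apply: right_ideal_sum => // i si.
exact: KF.
Qed.

Lemma coef_inM (a b : A) : coef_in K a -> coef_in K (a * b).
Proof.
move=> Ka; have [s _ ->] := coef_expansion a; rewrite mulr_suml.
apply: coef_in_sum => alpha _; rewrite -mulrA; exact: coef_in_iotaM.
Qed.

Lemma coef_inB (a b : A) : coef_in K a -> coef_in K b -> coef_in K (a - b).
Proof.
by move=> Ka Kb; apply: coef_inD => //; rewrite -mulrN1; apply: coef_inM.
Qed.

End CoefIn.

(** * Products of variables *)

(** The product of the variables along the word [w]. *)
Definition wprod (w : seq 'I_n) : A := \prod_(i <- w) x i.

(** The exponent counting the letters of [w]. *)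
Definition wexp (w : seq 'I_n) : exponent n := [ffun i => count_mem i w].

(** The total degree. *)
Definition edeg (alpha : exponent n) : nat := \sum_(i < n) alpha i.

(** The nondecreasing word of exponent [alpha]. *)
Definition eword (alpha : exponent n) : seq 'I_n :=
  flatten [seq nseq (alpha i) i | i <- enum 'I_n].

Lemma edeg_wexp (w : seq 'I_n) : edeg (wexp w) = size w.
Proof.
rewrite /edeg; under eq_bigr => i _ do rewrite ffunE.
elim: w => [|j w IH]; first by rewrite big1.
rewrite /= -IH big_split /= -add1n; congr addn.
rewrite (bigD1 j) //= eqxx big1 // => i; rewrite eq_sym => /negbTE ->.
by [].
Qed.

Lemma wexp_eword (alpha : exponent n) : wexp (eword alpha) = alpha.
Proof.
apply/ffunP => i; rewrite ffunE /eword count_flatten -map_comp sumnE big_map.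
rewrite big_enum /= (bigD1 i) //= count_nseq /= eqxx mul1n.
rewrite big1 ?addn0 // => j ji.
by rewrite count_nseq /= (negbTE ji).
Qed.

Lemma perm_eword_wexp (w : seq 'I_n) : perm_eq w (eword (wexp w)).
Proof.
apply/allP => i _ /=.
by have /ffunP/(_ i) := wexp_eword (wexp w); rewrite !ffunE => ->.
Qed.

Lemma wprod_eword (alpha : exponent n) : wprod (eword alpha) = monomial x alpha.
Proof.
rewrite /wprod /monomial big_flatten big_map enumT.
by apply: eq_bigr => i _; rewrite big_nseq iter_mulr mulr1.
Qed.

Lemma size_eword (alpha : exponent n) : size (eword alpha) = edeg alpha.
Proof. by rewrite -edeg_wexp wexp_eword. Qed.

Lemma wexp_cat (w1 w2 : seq 'I_n) (i : 'I_n) :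
  wexp (w1 ++ w2) i = (wexp w1 i + wexp w2 i)%N.
Proof. by rewrite !ffunE count_cat. Qed.

Let ordle : rel 'I_n := fun i j => (i <= j)%N.

Lemma eword_sorted (alpha : exponent n) : sorted ordle (eword alpha).
Proof.
have ordle_trans : transitive ordle by move=> j i k; apply: leq_trans.
rewrite sorted_pairwise // /eword.
have : pairwise ordle (enum 'I_n).
  rewrite -sorted_pairwise //.
  by have := iota_sorted 0 n; rewrite -val_enum_ord sorted_map.
elim: (enum 'I_n) => //= i s IH /andP[/allP is_le /IH s_le].
rewrite pairwise_cat s_le andbT; apply/andP; split.
  apply/allrelP => j k /nseqP[-> _] /flatten_mapP[l ls /nseqP[-> _]].
  exact: is_le.
elim: (alpha i) => //= m ->; rewrite andbT.
by apply/allP => j /nseqP[-> _]; apply: leqnn.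
Qed.

Lemma wprod_sorted (w : seq 'I_n) :
  sorted ordle w -> wprod w = monomial x (wexp w).
Proof.
move=> ws; rewrite -wprod_eword; congr wprod.
apply: (@sorted_eq _ ordle) => //; last exact: perm_eword_wexp.
- by move=> j i k; apply: leq_trans.
- by move=> i j /anti_leq/val_inj.
exact: eword_sorted.
Qed.

(** * Filtration by degree and leading terms *)

Variable sigma : 'I_n -> {rmorphism R -> R}.
Variable delta : 'I_n -> {additive R -> R}.
Hypothesis hcomm : forall i (r : R),
  x i * iota r = iota (sigma i r) * x i + iota (delta i r).

(** The left [R]-span of the products of fewer than [d] variables, in any
    order. *)
Inductive wspan (d : nat) : A -> Prop :=
| wspan0 : wspan d 0
| wspan_add r w b : (size w < d)%N -> wspan d b ->
    wspan d (iota r * wprod w + b).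

Lemma wspanD (d : nat) (a b : A) : wspan d a -> wspan d b -> wspan d (a + b).
Proof.
move=> ha hb; elim: ha => [|r w a' hw _ IH]; first by rewrite add0r.
by rewrite -addrA; apply: wspan_add.
Qed.

Lemma wspanZ (d : nat) (r : R) (a : A) : wspan d a -> wspan d (iota r * a).
Proof.
elim=> [|s w b hw _ IH]; first by rewrite mulr0; apply: wspan0.
by rewrite mulrDr mulrA -rmorphM; apply: wspan_add.
Qed.

Lemma wspan_wprod (d : nat) (r : R) (w : seq 'I_n) :
  (size w < d)%N -> wspan d (iota r * wprod w).
Proof. by move=> hw; rewrite -[_ * _]addr0; apply: wspan_add => //; left. Qed.

Lemma wspan_xl (d : nat) (i : 'I_n) (a : A) :
  wspan d a -> wspan d.+1 (x i * a).
Proof.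
elim=> [|r w b hw _ IH]; first by rewrite mulr0; apply: wspan0.
rewrite mulrDr mulrA hcomm mulrDl -mulrA; apply: wspanD => //.
have -> : x i * wprod w = wprod (i :: w) by rewrite /wprod big_cons.
by apply: wspanD; apply: wspan_wprod => //=; apply: ltnW.
Qed.

Lemma wspan_wprodr (d : nat) (w : seq 'I_n) (a : A) :
  wspan d a -> wspan (d + size w) (a * wprod w).
Proof.
elim=> [|r v b hv _ IH]; first by rewrite mul0r; apply: wspan0.
rewrite mulrDl -mulrA -[wprod v * _]big_cat.
by apply: wspan_add => //; rewrite size_cat ltn_add2r.
Qed.

(** The composition of the [sigma i] along [w], the first letter of [w] being
    applied last. *)
Definition wsigma (w : seq 'I_n) (r : R) : R := foldr (fun i => sigma i) r w.

Lemma wprod_iota (w : seq 'I_n) (r : R) :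
  exists2 g, wspan (size w) g
    & wprod w * iota r = iota (wsigma w r) * wprod w + g.
Proof.
elim: w => [|i w [g hg IH]].
  exists 0; first exact: wspan0.
  by rewrite /wprod big_nil mul1r mulr1 addr0.
exists (iota (delta i (wsigma w r)) * wprod w + x i * g).
  by apply: wspanD; [apply: wspan_wprod | apply: wspan_xl].
rewrite /wprod big_cons -/(wprod w) -mulrA IH mulrDr mulrA hcomm.
by rewrite mulrDl -!mulrA addrA.
Qed.

Variable c : 'I_n -> 'I_n -> R.
Hypothesis hc : forall i j : 'I_n, swap_coefficient iota x i j (c i j).
Hypothesis hcentral : forall i j : 'I_n, central (c i j).

Lemma swap_relation (i j : 'I_n) :
  exists r0 (r : 'I_n -> R), x j * x i =
    iota (c i j) * x i * x j + (iota r0 + \sum_(k < n) iota (r k) * x k).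
Proof.
have [_ [r0 [r E]]] := hc i j; exists r0, r.
by rewrite -E addrCA addrN addr0.
Qed.

Lemma coef_linear (r0 : R) (r : 'I_n -> R) (alpha : exponent n) :
  (1 < edeg alpha)%N ->
  coef (iota r0 + \sum_(k < n) iota (r k) * x k) alpha = 0.
Proof.
move=> halpha.
have small (w : seq 'I_n) s : (size w < 2)%N ->
    coef (iota s * wprod w) alpha = 0.
  move=> hw; rewrite wprod_sorted; last by case: w hw => [|? []].
  rewrite coefZ coef_monomial; case: eqP => [E|_]; last by rewrite mulr0.
  by move: halpha; rewrite -E edeg_wexp ltnNge -ltnS hw.
rewrite coefD coef_sum.
have -> : iota r0 = iota r0 * wprod [::] by rewrite /wprod big_nil mulr1.
rewrite small // add0r big1 // => k _.
have -> : x k = wprod [:: k] by rewrite /wprod big_seq1.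
exact: small.
Qed.

(** Exchanging two variables twice gives back the same monomial, so the two
    commutation coefficients are inverse to each other; centrality is what
    makes the inverse two-sided. *)
Lemma swap_coefficient_inv (i j : 'I_n) : i != j -> c i j * c j i = 1.
Proof.
wlog ij : i j / (i < j)%N => [H|_].
  rewrite neq_ltn => /orP[ij|ji]; first by apply: H; rewrite // neq_ltn ij.
  by rewrite (hcentral i j) H // neq_ltn ji.
rewrite (hcentral i j).
have [r0 [r E]] := swap_relation i j; have [s0 [s F]] := swap_relation j i.
have mE : x i * x j = monomial x (wexp [:: i; j]).
  rewrite -wprod_sorted; first by rewrite /wprod big_cons big_seq1.
  by rewrite /= andbT /ordle ltnW.
have d2 : (1 < edeg (wexp [:: i; j]))%N by rewrite edeg_wexp.
move/(congr1 (coef^~ (wexp [:: i; j]))): F.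
rewrite -mulrA E -mulrA mE coefD coefZ coefD coefZ coef_monomial eqxx.
by rewrite !coef_linear // !addr0 !mulr1.
Qed.

(** [wprod w] is [wprod v] up to a right invertible coefficient and terms of
    lower degree. *)
Definition wequiv (w v : seq 'I_n) : Prop :=
  exists u, (exists u', u * u' = 1) /\
    exists2 g, wspan (size w) g & wprod w = iota u * wprod v + g.

Lemma wequiv_refl (w : seq 'I_n) : wequiv w w.
Proof.
exists 1; split; first by exists 1; rewrite mulr1.
by exists 0; [left | rewrite rmorph1 mul1r addr0].
Qed.

Lemma wequiv_trans (w2 w1 w3 : seq 'I_n) :
  size w1 = size w2 -> wequiv w1 w2 -> wequiv w2 w3 -> wequiv w1 w3.
Proof.
move=> w12 [u [[u' uu'] [g hg E]]] [v [[v' vv'] [h hh F]]].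
exists (u * v); split.
  by exists (v' * u'); rewrite mulrA -(mulrA u) vv' mulr1.
exists (iota u * h + g); last by rewrite E F mulrDr mulrA -rmorphM addrA.
by apply: wspanD => //; apply: wspanZ; rewrite w12.
Qed.

Lemma wequiv_cons (i : 'I_n) (w v : seq 'I_n) :
  size w = size v -> wequiv w v -> wequiv (i :: w) (i :: v).
Proof.
move=> wv [u [[u' uu'] [g hg E]]]; exists (sigma i u); split.
  by exists (sigma i u'); rewrite -rmorphM uu' rmorph1.
exists (iota (delta i u) * wprod v + x i * g).
  by apply: wspanD; [apply: wspan_wprod; rewrite /= wv | apply: wspan_xl].
rewrite /wprod !big_cons -/(wprod w) -/(wprod v) E mulrDr mulrA hcomm.
by rewrite mulrDl -!mulrA addrA.
Qed.

Lemma wequiv_swap (i j : 'I_n) (w : seq 'I_n) :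
  wequiv (i :: j :: w) (j :: i :: w).
Proof.
have [->|ij] := eqVneq i j; first exact: wequiv_refl.
have [r0 [r E]] := swap_relation j i.
exists (c j i); split.
  by exists (c i j); apply: swap_coefficient_inv; rewrite eq_sym.
exists ((iota r0 + \sum_(k < n) iota (r k) * x k) * wprod w); last first.
  rewrite /wprod !big_cons -/(wprod w) mulrA E mulrDl.
  by rewrite !mulrA.
apply: (@wspan_wprodr 2); apply: wspanD.
  rewrite -[iota r0]mulr1.
  have -> : 1 = wprod [::] by rewrite /wprod big_nil.
  exact: wspan_wprod.
elim/big_ind: _ => [|a b|k _]; [by left | exact: wspanD |].
have -> : x k = wprod [:: k] by rewrite /wprod big_seq1.
exact: wspan_wprod.
Qed.

Lemma wequiv_move (i : 'I_n) (w v : seq 'I_n) :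
  wequiv (i :: w ++ v) (w ++ i :: v).
Proof.
elim: w => [|j w IH]; first exact: wequiv_refl.
apply: (@wequiv_trans (j :: i :: w ++ v)) => //; first exact: wequiv_swap.
by apply: wequiv_cons => //; rewrite /= !size_cat addnS.
Qed.

Lemma wequiv_perm (w v : seq 'I_n) : perm_eq w v -> wequiv w v.
Proof.
elim: w v => [|i w IH] v.
  rewrite perm_sym => /perm_nilP->; exact: wequiv_refl.
move=> wv; have : i \in v by rewrite -(perm_mem wv) mem_head.
move=> iv; case/splitPr: iv wv => v1 v2 wv.
have {}wv : perm_eq w (v1 ++ v2).
  rewrite -(perm_cons i) (perm_trans wv) //.
  exact: permEl (perm_catCA v1 [:: i] v2).
have sz := perm_size wv.
apply: (@wequiv_trans (i :: v1 ++ v2)); first by rewrite /= sz.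
  by apply: wequiv_cons => //; apply: IH.
exact: wequiv_move.
Qed.

(** A product of variables is a monomial up to a right invertible coefficient
    and terms of lower degree. *)
Lemma wprod_monomial (w : seq 'I_n) :
  exists u, (exists u', u * u' = 1) /\
    exists2 g, wspan (size w) g
      & wprod w = iota u * monomial x (wexp w) + g.
Proof.
have [u [hu hg]] := wequiv_perm (perm_eword_wexp w).
by exists u; split=> //; rewrite -wprod_eword.
Qed.

(** The span of the products of fewer than [d] variables is contained in that
    of the monomials of degree less than [d]. *)
Lemma coef_wspan (d : nat) (a : A) (alpha : exponent n) :
  wspan d a -> (d <= edeg alpha)%N -> coef a alpha = 0.
Proof.
elim/ltn_ind: d a alpha => d IH a alpha ha hd.
elim: ha => [|r w b hw _ IHb]; first exact: coef0.
have [u [_ [g hg ->]]] := wprod_monomial w.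
rewrite coefD IHb addr0 coefZ coefD coefZ coef_monomial.
rewrite (IH _ hw _ _ hg) ?(leq_trans (ltnW hw)) // addr0.
case: eqP => [E|_]; last by rewrite !mulr0.
by have := leq_trans hw hd; rewrite -E edeg_wexp ltnn.
Qed.

(** The leading term of a product of two terms. *)
Lemma coef_monomial_mul (beta gamma : exponent n) (r : R) :
  exists u, (exists u', u * u' = 1) /\
    forall alpha, (edeg beta + edeg gamma <= edeg alpha)%N ->
      coef (monomial x beta * (iota r * monomial x gamma)) alpha =
      wsigma (eword beta) r * u *+ (wexp (eword beta ++ eword gamma) == alpha).
Proof.
have [u [hu [h hh E]]] := wprod_monomial (eword beta ++ eword gamma).
exists u; split=> // alpha halpha.
rewrite mulrA -!wprod_eword.
have [g hg ->] := wprod_iota (eword beta) r.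
have -> : (iota (wsigma (eword beta) r) * wprod (eword beta) + g)
    * wprod (eword gamma) =
    iota (wsigma (eword beta) r) * wprod (eword beta ++ eword gamma)
    + g * wprod (eword gamma).
  by rewrite mulrDl -mulrA [wprod (_ ++ _)]big_cat.
rewrite E coefD coefZ coefD coefZ coef_monomial.
rewrite (coef_wspan hh) ?size_cat ?size_eword // addr0.
rewrite (coef_wspan (wspan_wprodr _ hg)) ?size_eword // addr0.
by rewrite mulr_natr mulrnAr.
Qed.

(** * The ideal of elements with nilpotent coordinates *)

Hypothesis iota_inj : injective iota.
Hypothesis hrev : reversible_ring R.
Hypothesis hcompat : Sigma_Delta_compatible sigma delta.

Let orbit := skew_orbit sigma delta.
Let nilR := @is_nilpotent R.

(** Moving [a] to the left through [z] replaces it by elements of its orbit. *)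
Lemma coef_in_iota_orbit (K : R -> Prop) (hK : right_ideal K) (a r : R) :
  (forall s b, orbit a b -> K (r * s * b)) ->
  forall z y : A, coef_in K (iota r * z * iota a * y).
Proof.
move=> H z y.
have step (w : seq 'I_n) b s y' : orbit a b ->
    coef_in K (iota (r * s) * wprod w * iota b * y').
  elim/last_ind: w b y' => [|w i IH] b y' ab.
    rewrite /wprod big_nil mulr1 -rmorphM; apply: coef_in_iotaM => //.
    exact: H.
  rewrite /wprod -cats1 big_cat big_seq1 /= -/(wprod w).
  rewrite -(mulrA _ _ (iota b)) -(mulrA (wprod w)) hcomm !mulrDr mulrDl.
  apply: coef_inD => //; rewrite ?mulrA -?(mulrA _ (x i)); apply: IH.
    exact: skew_orbit_sigma.
  exact: skew_orbit_delta.
have [t _ ->] := coef_expansion z.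
rewrite mulr_sumr !mulr_suml; apply: coef_in_sum => // alpha _.
rewrite -wprod_eword mulrA -rmorphM; apply: step; exact: skew_orbit_refl.
Qed.

Section PrincipalNilpotent.

Variables (a : R) (p : nat).
Hypothesis ap : a ^+ p = 0.

Let Kann := orbit_annihilator sigma delta a.
Let KannP k : right_ideal (Kann k) :=
  orbit_annihilator_right_ideal hrev sigma delta a k.

(** The elements of [A] that, multiplying on the right, lower by one the number
    of orbit elements needed for annihilation. They form a two-sided ideal
    that contains [iota a], and they are nilpotent since [a ^+ p = 0]. *)
Definition lowers_annihilator (z : A) : Prop :=
  forall k h, coef_in (Kann k.+1) h -> coef_in (Kann k) (h * z).

Lemma lowers_annihilator_iota (y z : A) :
  lowers_annihilator (y * iota a * z).
Proof.
move=> k h hh; have [t _ ->] := coef_expansion h.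
rewrite mulr_suml; apply: (coef_in_sum (KannP k)) => alpha _.
rewrite -mulrA !mulrA -(mulrA (iota _)).
apply: (coef_in_iota_orbit (KannP k)) => s b.
by apply: (orbit_annihilator_step hrev); apply: hh.
Qed.

Lemma lowers_annihilatorD (y z : A) :
  lowers_annihilator y -> lowers_annihilator z -> lowers_annihilator (y + z).
Proof.
move=> hy hz k h hh; rewrite mulrDr.
by apply: (coef_inD (KannP k)); [apply: hy | apply: hz].
Qed.

Lemma lowers_annihilatorMl (y z : A) :
  lowers_annihilator z -> lowers_annihilator (y * z).
Proof.
by move=> hz k h hh; rewrite mulrA; apply/hz/(coef_inM (KannP k.+1)).
Qed.

Lemma lowers_annihilator_exp (z : A) : lowers_annihilator z -> z ^+ p = 0.
Proof.
move=> hz.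
have H j k h : coef_in (Kann (k + j)) h -> coef_in (Kann k) (h * z ^+ j).
  elim: j k h => [|j IH] k h; first by rewrite addn0 mulr1.
  rewrite exprSr mulrA addnS -addSn => /IH; exact: hz.
have h1 : coef_in (Kann (0 + p)) (iota 1 * 1).
  apply: (coef_in_iotaM (KannP _)) => bs bsp hbs.
  by rewrite -(expr0 a) (prod_skew_orbit_eq0 hrev hcompat hbs) // bsp.
apply: coef_eq0 => alpha.
have := H p 0%N _ h1; rewrite rmorph1 mulr1 mul1r => /(_ alpha [::] erefl).
by rewrite big_nil mulr1; apply.
Qed.

Lemma nilpotent_add_iota (y g : A) :
  is_nilpotent g -> is_nilpotent (iota a * y + g).
Proof.
case=> k gk; exists (k * p)%N.
have [w hw E] : exists2 w, lowers_annihilator w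
    & (iota a * y + g) ^+ k = g ^+ k + w.
  elim: k {gk} => [|k [w hw IH]].
    exists (0 * iota a * 0); first exact: lowers_annihilator_iota.
    by rewrite mulr0 addr0.
  exists (1 * iota a * (y * (iota a * y + g) ^+ k) + g * w).
    apply: lowers_annihilatorD; first exact: lowers_annihilator_iota.
    exact: lowers_annihilatorMl.
  by rewrite exprS mulrDl {2}IH mulrDr -exprS mul1r mulrA addrCA.
by rewrite exprM E gk add0r lowers_annihilator_exp.
Qed.

End PrincipalNilpotent.

Lemma nilpotent_lincomb (I : eqType) (s : seq I) (F : I -> R) (Y : I -> A) :
  (forall i, i \in s -> nilR (F i)) ->
  is_nilpotent (\sum_(i <- s) iota (F i) * Y i).
Proof.
elim: s => [|i s IH] H; first by rewrite big_nil; exists 1%N; rewrite expr1.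
have [p ap] := H i (mem_head i s).
rewrite big_cons; apply: (nilpotent_add_iota ap); apply: IH => j js.
by apply: H; rewrite in_cons js orbT.
Qed.

Lemma nilpotent_iota (r : R) : is_nilpotent (iota r) <-> nilR r.
Proof.
split=> -[k E]; exists k; last by rewrite -rmorphXn E rmorph0.
by apply: iota_inj; rewrite rmorphXn E rmorph0.
Qed.

Lemma nilpotent_right_ideal : right_ideal nilR.
Proof.
split; first by exists 1%N; rewrite expr1.
  move=> a b ha hb; apply/nilpotent_iota; rewrite rmorphD.
  have := @nilpotent_lincomb R [:: a; b] id (fun=> 1).
  rewrite big_cons big_seq1 /= !mulr1; apply=> i.
  by rewrite !inE => /orP[]/eqP->.
move=> a r ha; apply/nilpotent_iota; rewrite rmorphM.
have := @nilpotent_lincomb R [:: a] id (fun=> iota r).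
by rewrite big_seq1; apply=> i; rewrite inE => /eqP->.
Qed.

Lemma nilpotent_mull (r a : R) : nilR a -> nilR (r * a).
Proof.
have [_ _ NM] := nilpotent_right_ideal => ha.
have [k hk] := NM _ r ha.
exists k.+1; rewrite exprSr mulrA.
have -> : (r * a) ^+ k * r = r * (a * r) ^+ k.
  elim: k {hk} => [|k IH]; first by rewrite mul1r mulr1.
  by rewrite !exprS -mulrA IH !mulrA.
by rewrite hk mulr0 mul0r.
Qed.

Lemma coef_in_nil_mull (z f : A) : coef_in nilR f -> coef_in nilR (z * f).
Proof.
move=> hf; have [s _ ->] := coef_expansion f.
have N := nilpotent_right_ideal.
rewrite mulr_sumr; apply: coef_in_sum => // alpha _.
rewrite mulrA -(mul1r z) -(rmorph1 iota).
apply: coef_in_iota_orbit => // r b hb.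
apply/nilpotent_mull/(nilpotent_skew_orbit hrev hcompat hb); exact: hf.
Qed.

Lemma nilpotent_coef_in (f : A) : coef_in nilR f -> is_nilpotent f.
Proof.
move=> hf; have [s _ ->] := coef_expansion f.
by apply: nilpotent_lincomb => alpha _; apply: hf.
Qed.

(** * Nilpotent elements have nilpotent coordinates *)

Lemma nilpotent_mul_wsigma (w : seq 'I_n) (a b : R) :
  nilR (a * wsigma w b) -> nilR (a * b).
Proof. by elim: w => //= i w IH /(nilpotent_mul_sigma hrev hcompat). Qed.

(** The sum of the squares. *)
Definition sqnorm (alpha : exponent n) : nat := \sum_(i < n) alpha i ^ 2.

(** An extreme point: of two exponents of sum [2 alpha] that differ from
    [alpha], one has a square norm larger than that of [alpha], by the
    parallelogram identity. *)
Lemma sqnorm_midpoint (alpha beta gamma : exponent n) :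
  wexp (eword beta ++ eword gamma) = wexp (eword alpha ++ eword alpha) ->
  (sqnorm beta <= sqnorm alpha)%N -> (sqnorm gamma <= sqnorm alpha)%N ->
  beta = alpha /\ gamma = alpha.
Proof.
move=> /ffunP E hb hg.
have {}E i : (beta i + gamma i = alpha i + alpha i)%N.
  by have := E i; rewrite !wexp_cat !wexp_eword.
pose d i := ((beta i - alpha i) + (alpha i - beta i))%N.
have H : (sqnorm beta + sqnorm gamma =
    (sqnorm alpha + sqnorm alpha) + \sum_(i < n) 2 * d i ^ 2)%N.
  rewrite /sqnorm -!big_split /=; apply: eq_bigr => i _; rewrite /d.
  have := E i; case: (leqP (beta i) (alpha i)) => h; nia.
have := leq_add hb hg; rewrite H -[leqRHS]addn0 leq_add2l leqn0.
rewrite sum_nat_eq0 => /forallP {}H.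
have {}H i : beta i = alpha i.
  by have := H i; rewrite /= muln_eq0 expn_eq0 /= andbT addn_eq0; lia.
by split; apply/ffunP => i //; have := E i; rewrite H => /addnI.
Qed.

Lemma seq_argmax (T : eqType) (f : T -> nat) (s : seq T) :
  s != [::] -> exists2 y, y \in s & forall z, z \in s -> (f z <= f y)%N.
Proof.
elim: s => // y [|z s] IH _.
  by exists y => [|z]; rewrite inE ?eqxx // => /eqP->.
have [//|m ms hm] := IH; have [h|h] := leqP (f m) (f y).
  exists y; first exact: mem_head.
  by move=> z'; rewrite in_cons => /predU1P[->//|/hm/leq_trans]; apply.
exists m; first by rewrite in_cons ms orbT.
move=> z'; rewrite in_cons => /predU1P[->|/hm//].
exact: ltnW.
Qed.

(** The exponent selected is one of largest square norm among those of largest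
    degree. *)
Lemma leading_exponent (t : seq (exponent n)) :
  t != [::] -> exists2 alpha, alpha \in t &
    forall beta, beta \in t -> (edeg beta <= edeg alpha)%N /\
      (edeg beta = edeg alpha -> sqnorm beta <= sqnorm alpha)%N.
Proof.
case/(seq_argmax edeg) => alpha0 h0 max0.
have [|alpha] := @seq_argmax _ sqnorm [seq b <- t | edeg b == edeg alpha0].
  apply/eqP => E.
  have := mem_filter (fun b => edeg b == edeg alpha0) alpha0 t.
  by rewrite E h0 eqxx.
rewrite mem_filter => /andP[/eqP Ea at_] maxa; exists alpha => // beta bt.
rewrite Ea; split; first exact: max0.
by move=> Eb; apply: maxa; rewrite mem_filter Eb eqxx.
Qed.

(** Only the square of the term of exponent [alpha] contributes to the
    coordinate of [f * f] at [2 alpha]. *)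
Lemma nilpotent_leading_coef (t : seq (exponent n)) (F : exponent n -> R)
    (alpha : exponent n)
    (f := \sum_(beta <- t) iota (F beta) * monomial x beta) :
  uniq t -> alpha \in t ->
  (forall beta, beta \in t -> (edeg beta <= edeg alpha)%N /\
      (edeg beta = edeg alpha -> sqnorm beta <= sqnorm alpha)%N) ->
  coef_in nilR (f * f) -> nilR (F alpha).
Proof.
move=> ut at_ hmax hff.
have [_ _ NM] := nilpotent_right_ideal.
pose mu := wexp (eword alpha ++ eword alpha).
have Emu : edeg mu = (edeg alpha + edeg alpha)%N.
  by rewrite edeg_wexp size_cat !size_eword.
have zero beta gamma : beta \in t -> gamma \in t ->
    ~~ ((beta == alpha) && (gamma == alpha)) ->
    coef (monomial x beta * (iota (F gamma) * monomial x gamma)) mu = 0.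
  move=> bt gt neq; have [hb1 hb2] := hmax _ bt; have [hg1 hg2] := hmax _ gt.
  have [u [_ ->]] := coef_monomial_mul beta gamma (F gamma); last first.
    by rewrite Emu leq_add.
  case: eqP => // E; case/negP: neq.
  have Ed : (edeg beta + edeg gamma = edeg alpha + edeg alpha)%N.
    by rewrite -Emu -E edeg_wexp size_cat !size_eword.
  have [||-> ->] := sqnorm_midpoint E; rewrite ?eqxx //.
    by apply: hb2; lia.
  by apply: hg2; lia.
have [u [[u' uu'] Eu]] := coef_monomial_mul alpha alpha (F alpha).
have : coef (f * f) mu = F alpha * (wsigma (eword alpha) (F alpha) * u).
  rewrite /f mulr_suml coef_sum (bigD1_seq alpha) //=.
  rewrite [X in _ + X]big_seq_cond [X in _ + X]big1 => [|beta /andP[bt ba]].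
    rewrite addr0 -mulrA coefZ [monomial _ _ * _]mulr_sumr coef_sum.
    rewrite (bigD1_seq alpha) //= [X in _ + X]big_seq_cond.
    rewrite [X in _ + X]big1 => [|gamma /andP[gt ga]].
      by rewrite addr0 Eu ?Emu // eqxx.
    by apply: zero; rewrite // eqxx.
  rewrite -mulrA coefZ [monomial _ _ * _]mulr_sumr coef_sum.
  rewrite big_seq big1 ?mulr0 // => gamma gt.
  by apply: zero; rewrite // (negbTE ba).
move=> E; have := NM _ u' (hff mu); rewrite E.
rewrite -!mulrA uu' mulr1 => /nilpotent_mul_wsigma.
by case=> k hk; exists (2 * k)%N; rewrite exprM expr2.
Qed.

(** The leading term has a nilpotent coefficient; it is removed and the argument
    repeated. *)
Lemma coef_in_nil_square (f : A) : coef_in nilR (f * f) -> coef_in nilR f.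
Proof.
have N := nilpotent_right_ideal.
have [t ut fE] := coef_expansion f.
suff H m (s : seq (exponent n)) (F : exponent n -> R) : uniq s -> size s = m ->
    let g := \sum_(beta <- s) iota (F beta) * monomial x beta in
    coef_in nilR (g * g) -> coef_in nilR g.
  by move: (H _ t (coef f) ut erefl); rewrite /= -fE.
elim: m s => [|m IH] s us sm g.
  by move: (size0nil sm) => s0 _ alpha; rewrite /g s0 big_nil coef0; case: N.
move=> hgg; have [|alpha as_ hmax] := @leading_exponent s.
  by case: (s) sm.
have Fa := nilpotent_leading_coef us as_ hmax hgg.
have ha : coef_in nilR (iota (F alpha) * monomial x alpha).
  exact: coef_in_iotaM.
pose g' := \sum_(beta <- rem alpha s) iota (F beta) * monomial x beta.
have Eg : g = iota (F alpha) * monomial x alpha + g'.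
  by rewrite /g (big_rem alpha).
rewrite Eg; apply: coef_inD => //; apply: IH; first exact: rem_uniq.
  by rewrite size_rem // sm.
rewrite -/g'; set h := _ * _ in ha Eg.
have -> : g' * g' = g * g - h * g - g' * h.
  by rewrite -mulrBl {1}Eg addrAC addrN add0r -mulrBr Eg addrAC addrN add0r.
apply: coef_inB => //; last exact: coef_in_nil_mull.
by apply: coef_inB => //; apply: coef_inM.
Qed.

Lemma coef_in_nilpotent (f : A) : is_nilpotent f -> coef_in nilR f.
Proof.
case=> k fk.
have : coef_in nilR (f ^+ (2 ^ k)).
  have -> : f ^+ (2 ^ k) = 0.
    by rewrite -(subnK (ltnW (ltn_expl k (ltnSn 1)))) exprD fk mulr0.
  by move=> alpha; rewrite coef0; case: nilpotent_right_ideal.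
elim: k {fk} => [|k IH]; first by rewrite expr1.
by rewrite expnS mul2n -addnn exprD => /coef_in_nil_square.
Qed.

(** * Weak symmetry *)

Lemma coef_in_nilC (a b : A) : coef_in nilR (a * b) -> coef_in nilR (b * a).
Proof.
move=> hab; apply: coef_in_nil_square; rewrite -mulrA; apply: coef_in_nil_mull.
by rewrite mulrA; apply: coef_inM => //; apply: nilpotent_right_ideal.
Qed.

Lemma coef_in_nil_insert (a r b : A) :
  coef_in nilR (a * b) -> coef_in nilR (a * r * b).
Proof.
move=> /coef_in_nilC hba; apply: coef_in_nilC; rewrite mulrA.
by apply: coef_inM => //; apply: nilpotent_right_ideal.
Qed.

Lemma skew_PBW_weak_symmetric : weak_symmetric A.
Proof.
move=> a b d /coef_in_nilpotent habd; apply: nilpotent_coef_in.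
apply: coef_in_nil_square.
(* (adb)^2 is a b d with a factor d inserted after a, a factor a after b, and
   a last factor b *)
have -> : a * d * b * (a * d * b) = a * d * b * a * d * b by rewrite !mulrA.
apply: coef_inM; first exact: nilpotent_right_ideal.
apply: coef_in_nil_insert.
by rewrite -mulrA; apply: coef_in_nil_insert; rewrite mulrA.
Qed.

End Extension.

Theorem theorem4p6 (R A : pzRingType) (iota : {rmorphism R -> A})
    (n : nat) (x : 'I_n -> A)
    (hA : skew_PBW_extension iota x)
    (sigma : 'I_n -> {rmorphism R -> R}) (delta : 'I_n -> {additive R -> R})
    (hassoc : associated_families iota x sigma delta)
    (c : 'I_n -> 'I_n -> R)
    (hc : forall i j : 'I_n, swap_coefficient iota x i j (c i j))
    (hcentral : forall i j : 'I_n, central (c i j))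
    (hrev : reversible_ring R)
    (hcompat : Sigma_Delta_compatible sigma delta) :
  weak_symmetric R <-> weak_symmetric A.
Proof.
have [iota_inj hbasis _ _] := hA; have [_ _ hcomm] := hassoc.
split=> [_|hAsym].
  exact: (skew_PBW_weak_symmetric hbasis hcomm hc hcentral
    iota_inj hrev hcompat).
move=> a b d /(nilpotent_iota iota_inj); rewrite !rmorphM => /hAsym.
by rewrite -!rmorphM => /(nilpotent_iota iota_inj).
Qed.
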